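(* The following assertions hold: 1. For any $n\geq 3$, the images of $\mathrm{SO}(n)$ under linear maps to $\mathbb{R}^2$ are ''maximally convex'' in the following sense: there exists a linear map $\pi:\mathbb{R}^{n\times n}\to\mathbb{R}^3$ so that $\pi(\mathrm{SO}(n))$ is nonconvex. 2. The projection of $\mathrm{SO}(n)$ onto its diagonal is ''maximally convex'' in the following sense: for $A\in\mathbb{R}^{n\times n}$, let $\pi(X)=(X_{11},X_{22},\dots,X_{nn},\langle A,X\rangle)$. If $A$ is not itself diagonal, then $\pi(\mathrm{SO}(n))$ is not convex. 3. For any $n\geq 3$, the projection of $\mathrm{SO}(n)$ onto its strictly upper triangular entries is ''maximally convex'' in the following sense: if $\pi:\mathbb{R}^{n\times n}\to\mathbb{R}^m$ is any linear map with $\operatorname{rank}(\pi)>\binom{n}{2}$, then $\pi(\mathrm{SO}(n))$ is not convex. 4. The assumption $\det(C)\geq 0$ in the exactness result recalled in the context is necessary in the following sense: there exist $\sigma\in\mathbb{R}^{\binom{n}{2}}$ and a diagonal matrix $C$ so that $$\max_{X\in\mathrm{SO}(n)}\{\langle C,X\rangle:\ \pi_{\mathcal{T}}(X)=\sigma\}<\max_{X\in\operatorname{conv}(\mathrm{SO}(n))}\{\langle C,X\rangle:\ \pi_{\mathcal{T}}(X)=\sigma\}.$$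
   Context: $\mathrm{SO}(n)=\{X\in\mathbb{R}^{n\times n}: X^\intercal X=I,\ \det(X)=1\}$; $\operatorname{conv}$ denotes convex hull; $\langle A,X\rangle=\operatorname{tr}(A^\intercal X)$. The map $\pi_{\mathcal{T}}:\mathbb{R}^{n\times n}\to\mathbb{R}^{\binom{n}{2}}$, $\pi_{\mathcal{T}}(X)=(X_{ij})_{i<j}$, is the projection onto the strictly upper triangular entries. The exactness result referred to in item 4 is: if $C\in\mathbb{R}^{n\times n}$ is diagonal with $\det(C)\geq 0$, and $\mathcal{K}$ is a nonempty closed convex subset of $\pi_{\mathcal{T}}(B)$, where $B\subseteq\mathbb{R}^{n\times n}$ is the operator norm unit ball, then $\sup\{\langle C,X\rangle: X\in\mathrm{SO}(n),\ \pi_{\mathcal{T}}(X)\in\mathcal{K}\}=\max\{\langle C,X\rangle: X\in B,\ \pi_{\mathcal{T}}(X)\in\mathcal{K}\}$.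
   Formalization: Item 2 excludes n = 2 with A symmetric, where the image is a segment (convex) even if A is not diagonal; item 4 is stated for every n ≥ 3, since for n ≤ 2 the two maxima always coincide. *)

(* Defs.v *)
From mathcomp Require Export all_boot all_order all_algebra.
From mathcomp Require Export boolp classical_sets reals convex.

Set Implicit Arguments.
Unset Strict Implicit.
Unset Printing Implicit Defensive.

Import Order.TTheory GRing.Theory Num.Theory.
Local Open Scope classical_set_scope.
Local Open Scope ring_scope.

Section Defs.
Variable R : realType.

Definition SO (n : nat) : set 'M[R]_n :=
  [set X | X^T *m X = 1%:M /\ \det X = 1].

Definition frob (n : nat) (A X : 'M[R]_n) : R := \tr (A^T *m X).

Definition conv_hull (V : lmodType R) (A : set V) : set V :=
  smallest (@convex_set R V) A.

Definition is_max (A : set R) (x : R) : Prop := A x /\ ubound A x.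

(* X |-> (X_11, ..., X_nn, <A, X>), the last coordinate being a 1 x 1 block. *)
Definition diag_and (n : nat) (A X : 'M[R]_n) : 'rV[R]_(n + 1) :=
  row_mx (\row_i X i i) (frob A X)%:M.

End Defs.

(* The coordinates of R^(n choose 2) are labelled by the pairs i < j rather than
   by 'I_('C(n, 2)); card_upper_idx checks that there are 'C(n, 2) of them. *)
Definition upper_idx (n : nat) : finType := {p : 'I_n * 'I_n | (p.1 < p.2)%N}.

Definition upper_proj (R : realType) (n : nat) (X : 'M[R]_n) :
    {ffun upper_idx n -> R} :=
  [ffun p => X (val p).1 (val p).2].

Lemma card_upper_idx n : #|upper_idx n| = 'C(n, 2).
Proof.
rewrite card_sig -bin2_sum big_mkord.
rewrite -sum1_card (eq_bigl (fun p : 'I_n * 'I_n => true && (p.1 < p.2)%N)) //.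
rewrite -(pair_big_dep xpredT (fun i j : 'I_n => (i < j)%N) (fun _ _ => 1%N)) /=.
rewrite (exchange_big_dep xpredT) //=; apply: eq_bigr => j _.
by rewrite -(big_ord_widen n (fun=> 1%N)) ?(ltnW (ltn_ord j)) // sum1_card card_ord.
Qed.

Arguments SO R n : clear implicits.

(* Main.v *)
(* Items 1 and 2: a convex image would contain the midpoint of the images of two
   diagonal sign matrices that differ only in the entries i and j. For item 2, the
   diagonal of a preimage X of it forces X to be a signed permutation matrix
   swapping i and j, and then its off-diagonal entries contribute to <A, X>.

   Item 3 is a dimension count. A linear image of SO(n) has box dimension at most
   'C(n, 2), whereas the convex hull of SO(n) is a neighbourhood of 0 when n >= 3,
   so a convex image would have dimension \dim (limg pi) > 'C(n, 2).

   Item 4: let C = diag (-1, 1, ..., 1). Then <C, X> <= n - 2 on SO(n), with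
   equality iff C X is a reflection 1 - 2 v^T v with |v| = 1. Hence
   X_01 = 2 v_0 v_1, X_02 = 2 v_0 v_2 and X_12 = - 2 v_1 v_2 at a maximizer, so that
   X_12 = 0 excludes X_01 <> 0 <> X_02, which convex combinations of maximizers
   do achieve. *)
Require Import Defs.
From HB Require Import structures.
From mathcomp Require Import all_fingroup interval_inference ring lra.

Import Order.TTheory GRing.Theory Num.Theory.
Local Open Scope classical_set_scope.
Local Open Scope ring_scope.

(** * Convex sets and their images *)

Lemma convex_setE {R : realType} {M : lmodType R} (A : set M) :
  convex_set A <-> forall x y t,
    0 <= t -> t <= 1 -> A x -> A y -> A (t *: x + (1 - t) *: y).
Proof.
split=> cA x y t.
  move=> t0 t1 Ax Ay.
  by have /set_mem := cA x y (Itv01 t0 t1) (mem_set Ax) (mem_set Ay).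
by move=> /set_mem Ax /set_mem Ay; apply/mem_set/cA.
Qed.

Lemma convex_mid {R : realType} {M : lmodType R} {A : set M} {x y : M} :
  convex_set A -> A x -> A y -> A (2^-1 *: (x + y)).
Proof.
move=> /convex_setE cA Ax Ay; rewrite scalerDr.
have {2}-> : 2^-1 = 1 - 2^-1 :> R by lra.
by apply: cA => //; lra.
Qed.

(** Pulls a convex image back to a convex set of source vectors that contains [A], so that facts
    about convex sets of matrices containing SO(n) apply to it. *)
Lemma convex_image {R : realType} {M N : vectType R} (f : 'Hom(M, N))
    (A : set M) :
  convex_set (f @` A) -> convex_set [set x | (f @` A) (f x)].
Proof.
move=> /convex_setE cA; apply/convex_setE => x y t t0 t1 Ax Ay /=.
by rewrite linearD !linearZ; apply: cA.
Qed.

(** By induction the sum is its total weight times a point of [A]; the weight missing up to 1 is put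
    on the point 0. *)
Lemma convex_sum {R : realType} {M : lmodType R} (A : set M) (I : Type)
    (s : seq I) (t : I -> R) (x : I -> M) :
  convex_set A -> A 0 -> (forall i, 0 <= t i) -> (forall i, A (x i)) ->
  \sum_(i <- s) t i <= 1 -> A (\sum_(i <- s) t i *: x i).
Proof.
move=> /convex_setE cA A0 t0 Ax ts.
have [y Ay ->] : exists2 y, A y &
    \sum_(i <- s) t i *: x i = (\sum_(i <- s) t i) *: y.
  elim: s {ts} => [|i s [y Ay IH]].
    by exists 0; rewrite ?big_nil ?scaler0.
  rewrite !big_cons IH.
  have s0 : 0 <= \sum_(j <- s) t j by apply: sumr_ge0.
  have [z|nz] := eqVneq (t i + \sum_(j <- s) t j) 0.
    exists 0 => //; rewrite z scaler0.
    have -> : t i = 0 by move: (t0 i); lra.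
    have -> : \sum_(j <- s) t j = 0 by move: (t0 i); lra.
    by rewrite !scale0r addr0.
  set u := t i + _ in nz *.
  exists ((t i / u) *: x i + (1 - t i / u) *: y).
    have u0 : 0 < u by rewrite lt_neqAle eq_sym nz addr_ge0.
    apply: cA => //; first by rewrite divr_ge0 // ltW.
    by rewrite ler_pdivrMr // mul1r lerDl.
  rewrite scalerDr !scalerA mulrBr mulr1 mulrCA divff // mulr1.
  by congr (_ + _ *: _); rewrite /u addrC addKr.
rewrite -[_ *: y]addr0 -(scaler0 _ (1 - \sum_(i <- s) t i)).
by apply: cA => //; apply: sumr_ge0.
Qed.

(** * Signed permutation matrices and convex sets containing SO(n) *)

(** The entries of [d] are arbitrary, so that the same form covers matrices with some rows erased by
    zeros of [d]. *)
Definition signed_perm {R : realType} {n : nat} (d : 'rV[R]_n) (s : {perm 'I_n}) :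
    'M[R]_n := diag_mx d *m perm_mx s.

Lemma signed_permE {R : realType} {n : nat} (d : 'rV[R]_n) (s : {perm 'I_n}) i j :
  signed_perm d s i j = d 0 i * (s i == j)%:R.
Proof. by rewrite /signed_perm mul_diag_mx !mxE. Qed.

Lemma diag_sign_orth {R : realType} {n : nat} (d : 'rV[R]_n) :
  (forall i, d 0 i ^+ 2 = 1) -> (diag_mx d)^T *m diag_mx d = 1%:M.
Proof.
move=> d1; rewrite tr_diag_mx; apply/matrixP => i j; rewrite mul_diag_mx !mxE.
by case: eqP => [->|]; rewrite ?mulr1n ?mulr0n ?mulr0 // -expr2 d1.
Qed.

Lemma signed_perm_SO {R : realType} {n : nat} (d : 'rV[R]_n) (s : {perm 'I_n}) :
  (forall i, d 0 i ^+ 2 = 1) -> (\prod_i d 0 i) * (-1) ^+ s = 1 ->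
  SO R n (signed_perm d s).
Proof.
move=> d1 dp; split; last by rewrite /signed_perm det_mulmx det_diag det_perm.
rewrite /signed_perm trmx_mul -!mulmxA (mulmxA (diag_mx d)^T) diag_sign_orth //.
by rewrite mul1mx tr_perm_mx -perm_mxM mulVg perm_mx1.
Qed.

Lemma prod_sqr_eq1 {R : comPzRingType} {I : finType} (P : pred I) (F : I -> R) :
  (forall i, P i -> F i ^+ 2 = 1) -> (\prod_(i | P i) F i) ^+ 2 = 1.
Proof. by move=> F1; rewrite -prodrXl big1. Qed.

Section Hull.
Context {R : realType} {n : nat} {K : set 'M[R]_n}.
Hypotheses (cK : convex_set K) (SOK : SO R n `<=` K).

Let upd (d : 'rV[R]_n) i x := \row_k (if k == i then x else d 0 k).

Let zeros (d : 'rV[R]_n) := [set k | d 0 k == 0]%SET.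

Let zeros_upd (d : 'rV[R]_n) i x : d 0 i = 0 -> x != 0 ->
  zeros (upd d i x) = zeros d :\ i.
Proof.
move=> di x0; apply/setP => k; rewrite !inE mxE.
by case: (eqVneq k i) => [->|] //=; apply: negbTE.
Qed.

Let signs (d : 'rV[R]_n) := forall k, d 0 k = 0 \/ d 0 k ^+ 2 = 1.

Let signs_upd (d : 'rV[R]_n) i x : signs d -> x ^+ 2 = 1 -> signs (upd d i x).
Proof. by move=> sd x1 k; rewrite mxE; case: eqP => // _; right. Qed.

(** Zeros of [d] are filled in by averaging over the signs 1 and -1. One zero at a time is filled
    until two are left; these last two are filled together so that the determinant is 1. *)
Lemma hull_signed_perm (d : 'rV[R]_n) (s : {perm 'I_n}) :
  (forall k, d 0 k = 0 \/ d 0 k ^+ 2 = 1) ->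
  (1 < #|[set k | (d 0 k == 0)%R]%SET|)%N -> K (signed_perm d s).
Proof.
have N1 : (-1) ^+ 2 = 1 :> R by rewrite sqrrN expr1n.
have mid (d1 d2 d0 : 'rV[R]_n) : d0 = 2^-1 *: (d1 + d2) -> K (signed_perm d1 s) ->
    K (signed_perm d2 s) -> K (signed_perm d0 s).
  move=> -> h1 h2; have := convex_mid cK h1 h2.
  by rewrite /signed_perm -mulmxDl -linearD scalemxAl -linearZ.
have [m] := ubnP #|zeros d|; elim: m d => // m IH d dm sd z1.
have [i zi] : exists i, i \in zeros d by apply/card_gt0P; apply: ltn_trans z1.
have di : d 0 i = 0 by move: zi; rewrite inE => /eqP.
have ci : #|zeros d| = #|zeros d :\ i|.+1 by rewrite (cardsD1 i) zi.
have [z2|z2] := ltnP 2 #|zeros d|.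
  have c x : x ^+ 2 = 1 -> K (signed_perm (upd d i x) s).
    move=> x1; have x0 : x != 0 by rewrite -sqrf_eq0 x1 oner_eq0.
    apply: IH; first by rewrite zeros_upd // -ltnS -ci.
      exact: signs_upd.
    by rewrite -/(zeros _) zeros_upd // -ltnS -ci.
  apply: (mid (upd d i 1) (upd d i (-1))); last 2 first.
  - by apply: c; rewrite expr1n.
  - exact: c.
  apply/rowP => k; rewrite !mxE; case: eqP => [->|_]; last by lra.
  by rewrite di subrr mulr0.
have c2 : #|zeros d| = 2%N by apply/eqP; rewrite eqn_leq z1 z2.
have /cards1P[j Ej] : #|zeros d :\ i| == 1%N by rewrite -eqSS -ci c2.
have : j \in zeros d :\ i by rewrite Ej set11.
rewrite !inE => /andP[ji /eqP dj].
have dk k : k != i -> k != j -> d 0 k ^+ 2 = 1.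
  move=> ki kj; case: (sd k) => // d0; have : k \in zeros d :\ i.
    by rewrite !inE ki d0 eqxx.
  by rewrite Ej inE (negbTE kj).
(* With x at i and x p at j, the determinant is x^2 p^2 = 1 for both signs x, and both entries
   average to 0 over x = 1 and x = -1. *)
pose p := (\prod_(k | (k != i) && (k != j)) d 0 k) * (-1) ^+ s.
have p1 : p ^+ 2 = 1.
  rewrite exprMn sqrr_sign mulr1 prod_sqr_eq1 // => k /andP[]; exact: dk.
have c x : x ^+ 2 = 1 -> K (signed_perm (upd (upd d i x) j (x * p)) s).
  move=> x1; apply/SOK/signed_perm_SO => [k|].
    rewrite !mxE; case: eqP => [_|/eqP kj]; first by rewrite exprMn x1 p1 mulr1.
    by case: eqP => // /eqP ki; exact: dk.
  rewrite (bigD1 i) //= (bigD1 j) //= !mxE eqxx eq_sym (negbTE ji) eqxx.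
  under eq_bigr => k /andP[ki kj] do rewrite !mxE (negbTE ki) (negbTE kj).
  rewrite -!mulrA; set q := \prod_(_ | _) _.
  rewrite (mulrA q) -[q * _]/p -expr2 p1 mulr1 -expr2.
  exact: x1.
apply: (mid _ _ _ _ (c 1 _) (c (-1) _)); rewrite ?expr1n //.
apply/rowP => k; rewrite !mxE; case: eqP => [->|_]; first by rewrite dj; ring.
case: eqP => [->|_]; first by rewrite di; ring.
by lra.
Qed.

(** A signed matrix unit is a signed permutation matrix with n - 1 >= 2 rows erased, hence lies in
    [K]. The l1 ball is spanned by these, with weights [|M i j|]. *)
Lemma hull_l1_ball (M : 'M[R]_n) : (2 < n)%N ->
  \sum_i \sum_j `|M i j| <= 1 -> K M.
Proof.
move=> n3 M1.
have card_zeros (d : 'rV[R]_n) i : (forall k, k != i -> d 0 k = 0) ->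
    (1 < #|[set k | (d 0 k == 0)%R]%SET|)%N.
  move=> dk; have : [set~ i]%SET \subset [set k | d 0 k == 0]%SET.
    by apply/fintype.subsetP => k; rewrite !inE => /dk ->.
  move/subset_leq_card; apply: leq_trans.
  by rewrite cardsC1 card_ord -ltnS prednK // (ltn_trans _ n3).
have K0 : K 0.
  have -> : 0 = signed_perm 0 1%g :> 'M[R]_n by rewrite /signed_perm linear0 mul0mx.
  apply: hull_signed_perm; first by move=> k; left; rewrite mxE.
  by apply: (card_zeros _ (Ordinal (ltnW (ltnW n3)))) => k _; rewrite mxE.
rewrite [M]matrix_sum_delta pair_bigA /=.
have -> : \sum_p M p.1 p.2 *: delta_mx p.1 p.2 = \sum_(p : 'I_n * 'I_n)
    `|M p.1 p.2| *: (Num.sg (M p.1 p.2) *: delta_mx p.1 p.2) :> 'M[R]_n.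
  by apply: eq_bigr => p _; rewrite scalerA mulrC -numEsg.
apply: convex_sum => //; last by rewrite -(pair_bigA _ (fun i j => `|M i j|)).
move=> [i j] /=; set x := Num.sg _.
(* Any permutation sending i to j would do, as all other rows vanish. *)
have -> : x *: delta_mx i j = signed_perm (x *: delta_mx 0 i) (tperm i j).
  apply/matrixP => k l; rewrite signed_permE !mxE eqxx /=.
  case: (eqVneq k i) => [->|]; rewrite ?mulr0 ?mul0r // tpermL.
  by rewrite mulr1 eq_sym.
apply: hull_signed_perm => [k|]; last first.
  by apply: (card_zeros _ i) => k ki; rewrite !mxE (negbTE ki) andbF mulr0.
rewrite !mxE eqxx /=; case: eqP; rewrite ?mulr0 ?mulr1; last by left.
rewrite /x; case: sgrP => _; [by left|right|right]; by rewrite ?sqrrN expr1n.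
Qed.

End Hull.

(** * Entries of orthogonal matrices *)

Section Orthogonal.
Context {R : realType} {n : nat} {X : 'M[R]_n}.
Hypothesis oX : X^T *m X = 1%:M.

Lemma orth_col i : \sum_k X k i ^+ 2 = 1.
Proof.
have := congr1 (fun M : 'M_n => M i i) oX; rewrite !mxE eqxx mulr1n => <-.
by apply: eq_bigr => k _; rewrite mxE expr2.
Qed.

Lemma orth_row i : \sum_k X i k ^+ 2 = 1.
Proof.
have := congr1 (fun M : 'M_n => M i i) (mulmx1C oX); rewrite !mxE eqxx mulr1n => <-.
by apply: eq_bigr => k _; rewrite mxE expr2.
Qed.

Lemma orth_entry_le1 i j : `|X i j| <= 1.
Proof.
rewrite -(ler_pXn2r (n := 2)) ?nnegrE // expr1n real_normK ?num_real //.
rewrite -(orth_row i) (bigD1 j) //= lerDl; apply: sumr_ge0 => k _.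
exact: sqr_ge0.
Qed.

Lemma orth_unit_entry i j : X i j ^+ 2 = 1 ->
  (forall k, k != j -> X i k = 0) /\ (forall k, k != i -> X k j = 0).
Proof.
move=> Xij; split=> k kj; apply/eqP; rewrite -sqrf_eq0; apply/eqP.
  have := orth_row i; rewrite (bigD1 j) //= Xij => /(canRL (addKr _)).
  rewrite addrC subrr => s0; apply: (psumr_eq0P _ s0) => // l _.
  exact: sqr_ge0.
have := orth_col j; rewrite (bigD1 i) //= Xij => /(canRL (addKr _)).
rewrite addrC subrr => s0; apply: (psumr_eq0P _ s0) => // l _.
exact: sqr_ge0.
Qed.

Lemma orth_unit_diag i j : X i i ^+ 2 = 1 -> i != j -> X i j = 0 /\ X j i = 0.
Proof.
by move=> /orth_unit_entry[Xr Xc] ij; rewrite Xr ?Xc // eq_sym.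
Qed.

(** Each diagonal entry is at most 1, so the sum reaches its bound only if every term does. *)
Lemma sum_diag_eq_card (P : pred 'I_n) :
  \sum_(k | P k) X k k = \sum_(k | P k) 1 -> forall k, P k -> X k k = 1.
Proof.
move=> sX k Pk.
have s0 : \sum_(i | P i) (1 - X i i) = 0 by rewrite sumrB sX subrr.
have X1 i : P i -> 0 <= 1 - X i i.
  by move=> _; rewrite subr_ge0; apply: le_trans (orth_entry_le1 i i); apply: ler_norm.
by have/eqP := psumr_eq0P X1 s0 Pk; rewrite subr_eq0 => /eqP.
Qed.

End Orthogonal.

(** * The diagonal together with one further functional *)

Lemma frobE {R : realType} {n : nat} (A X : 'M[R]_n) :
  frob A X = \sum_i \sum_j A i j * X i j.
Proof.
rewrite /frob /mxtrace exchange_big; apply: eq_bigr => j _.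
by rewrite mxE; apply: eq_bigr => i _; rewrite mxE.
Qed.

Lemma frob_signed_perm {R : realType} {n : nat} (A : 'M[R]_n) (d : 'rV[R]_n)
    (s : {perm 'I_n}) :
  frob A (signed_perm d s) = \sum_i A i (s i) * d 0 i.
Proof.
rewrite frobE; apply: eq_bigr => i _; rewrite (bigD1 (s i)) //= big1 => [|j ji].
  by rewrite signed_permE eqxx mulr1 addr0.
by rewrite signed_permE eq_sym (negbTE ji) !mulr0.
Qed.

Lemma signed_perm_diag {R : realType} {n : nat} (d : 'rV[R]_n) :
  \row_k signed_perm d 1%g k k = d.
Proof. by apply/rowP => k; rewrite mxE signed_permE perm1 eqxx mulr1. Qed.

Section TwoIndices.
Context {R : realType} {n : nat} (i j : 'I_n).
Hypothesis ij : i != j.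

Let other k := (k != i) && (k != j).

(** For signs, the entry at j makes the product of all entries equal to 1. The entries at i and j
    are odd in x, so they cancel in the midpoint of x = 1 and x = -1. *)
Definition flip (d : 'rV[R]_n) (x : R) : 'rV[R]_n :=
  \row_k (if k == i then x else if k == j
    then x * \prod_(l | other l) d 0 l else d 0 k).

Lemma flip_SO (d : 'rV[R]_n) (x : R) : (forall k, d 0 k ^+ 2 = 1) -> x ^+ 2 = 1 ->
  SO R n (signed_perm (flip d x) 1%g).
Proof.
move=> d1 x1; have s1 : (\prod_(l | other l) d 0 l) ^+ 2 = 1.
  exact: prod_sqr_eq1.
apply: signed_perm_SO => [k|].
  by rewrite !mxE; case: eqP => // _; case: eqP => // _; rewrite exprMn x1 s1 mulr1.
rewrite odd_perm1 expr0 mulr1 (bigD1 i) //= (bigD1 j) 1?eq_sym //= !mxE eqxx.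
rewrite eq_sym (negbTE ij) eqxx.
rewrite [X in x * (_ * X)](_ : _ = \prod_(l | other l) d 0 l); last first.
  apply: eq_bigr => k /andP[ki kj]; by rewrite !mxE (negbTE ki) (negbTE kj).
set p := \prod_(_ | _) _ in s1 *.
by rewrite -mulrA -(expr2 p) s1 mulr1 -expr2.
Qed.

(** A diagonal entry of square 1 clears the rest of its row and column, so the rows i and j can only
    be completed by the entries (i, j) and (j, i). The determinant then ties their signs to the
    remaining diagonal. *)
Lemma zero_diag_pair {X : 'M[R]_n} : SO R n X ->
  X i i = 0 -> X j j = 0 -> (forall k, other k -> X k k ^+ 2 = 1) ->
  [/\ X = signed_perm (\row_k X k (tperm i j k)) (tperm i j),
      X i j ^+ 2 = 1 & X i j * X j i * \prod_(k | other k) X k k = -1].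
Proof.
move=> [oX dX] Xi Xj Xk.
have offk k l : other k -> k != l -> X k l = 0 /\ X l k = 0.
  by move=> /Xk; apply: orth_unit_diag.
have EX : X = signed_perm (\row_k X k (tperm i j k)) (tperm i j).
  apply/matrixP => k l; rewrite signed_permE mxE.
  case: (eqVneq _ l) => [->|]; first by rewrite mulr1.
  rewrite mulr0; case: tpermP => [->|->|/eqP ki /eqP kj].
  - move=> jl; case: (eqVneq l i) => [-> //|li].
    by apply: (proj2 (offk l i _ _)) => //; rewrite /other li eq_sym.
  - move=> il; case: (eqVneq l j) => [-> //|lj].
    by apply: (proj2 (offk l j _ _)) => //; rewrite /other lj eq_sym il.
  - by move=> kl; apply: (proj1 (offk k l _ _)) => //; rewrite /other ki.
split=> //.
  rewrite -(orth_row oX i) (bigD1 j) 1?eq_sym //= big1 ?addr0 // => k kj.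
  rewrite EX signed_permE tpermL eq_sym (negbTE kj) mulr0 expr0n //.
have := dX; rewrite {1}EX /signed_perm det_mulmx det_diag det_perm odd_tperm ij expr1.
rewrite (bigD1 i) //= (bigD1 j) 1?eq_sym //= !mxE tpermL tpermR mulrN1.
rewrite [Y in X i j * (_ * Y)](_ : _ = \prod_(k | other k) X k k); last first.
  by apply: eq_bigr => k /andP[ki kj]; rewrite mxE tpermD // eq_sym.
by move=> /eqP; rewrite eqr_oppLR mulrA => /eqP.
Qed.

(** Let s be the product of the signs other than those at i and j. A preimage X of the midpoint of
    the two flips has [X j i] = - s [X i j], so the last coordinate would force [A i j] = s
    [A j i]. *)
Lemma diag_and_nonconvex (A : 'M[R]_n) (d : 'rV[R]_n) :
  (forall k, d 0 k ^+ 2 = 1) ->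
  A i j != (\prod_(k | other k) d 0 k) * A j i ->
  ~ convex_set (diag_and A @` SO R n).
Proof.
move=> d1 Aij cK; set s := \prod_(k | other k) d 0 k in Aij.
have s1 : s ^+ 2 = 1 by apply: prod_sqr_eq1.
have im x : x ^+ 2 = 1 ->
    (diag_and A @` SO R n) (diag_and A (signed_perm (flip d x) 1%g)).
  by move=> x1; exists (signed_perm (flip d x) 1%g) => //; apply: flip_SO.
have := convex_mid cK (im 1 (expr1n _ _)) (im (-1) _).
rewrite sqrrN expr1n => /(_ erefl)[X SX].
rewrite /diag_and !signed_perm_diag add_row_mx scale_row_mx => /eq_row_mx[EX EA].
have dX k : X k k = if other k then d 0 k else 0.
  have /rowP/(_ k) := EX; rewrite !mxE => ->.
  rewrite /other; case: (eqVneq k i) => _ /=; first by rewrite subrr mulr0.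
  case: (eqVneq k j) => _ /=; last by lra.
  by rewrite mulN1r mul1r subrr mulr0.
have Xi : X i i = 0 by rewrite dX /other eqxx.
have Xj : X j j = 0 by rewrite dX /other eqxx andbF.
have [|EXp Xij] := zero_diag_pair SX Xi Xj.
  by move=> k ok; rewrite dX ok.
rewrite (eq_bigr (d 0)) => [|k ok]; last by rewrite dX ok.
rewrite -/s => Xijs.
have Fx x : frob A (signed_perm (flip d x) 1%g) =
    A i i * x + (A j j * (x * s) + \sum_(k | other k) A k k * d 0 k).
  rewrite frob_signed_perm (bigD1 i) //= (bigD1 j) 1?eq_sym //=.
  rewrite !perm1 !mxE eqxx eq_sym (negbTE ij) eqxx; congr (_ + (_ + _)).
  by apply: eq_bigr => k /andP[ki kj]; rewrite perm1 !mxE (negbTE ki) (negbTE kj).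
have FX : frob A X = A i j * X i j + (A j i * X j i + \sum_(k | other k) A k k * d 0 k).
  rewrite {1}EXp frob_signed_perm (bigD1 i) //= (bigD1 j) 1?eq_sym //=.
  rewrite !mxE tpermL tpermR; congr (_ + (_ + _)); apply: eq_bigr => k ok.
  have/andP[ki kj] := ok.
  by rewrite mxE !tpermD 1?(eq_sym _ k) // dX (_ : other k = true).
have /matrixP/(_ 0 0) := EA; rewrite !mxE !mulr1n !Fx FX => E.
have Xji : X j i = - s * X i j.
  transitivity (X i j ^+ 2 * X j i * s ^+ 2); first by rewrite Xij s1 mul1r mulr1.
  by rewrite -[RHS]mulr1 -[1]opprK -Xijs; ring.
have X0 : X i j != 0 by rewrite -sqrf_eq0 Xij oner_eq0.
move: Aij; rewrite -subr_eq0 => /negP; apply.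
rewrite -(mulrI_eq0 _ (lregP X0)); apply/eqP; move: E; rewrite Xji.
lra.
Qed.

End TwoIndices.

Lemma third_index {n : nat} (i j : 'I_n) : (2 < n)%N ->
  exists k, (k != i) && (k != j).
Proof.
move=> n3; have : (0 < #|~: [set i; j]|)%N.
  rewrite cardsCs finset.setCK card_ord subn_gt0 cards2.
  by apply: leq_ltn_trans n3; case: eqP.
by case/card_gt0P => k; rewrite !inE negb_or => h; exists k.
Qed.

(** If A is not symmetric, the sign s = 1 separates [A i j] from s [A j i] for some i, j. If A is
    symmetric, s = -1 does so at any nonzero off-diagonal entry, and a third index carries the minus
    sign. For n = 2 and A symmetric the image is a segment, whence the first hypothesis. *)
Lemma SO_diag_maximally_convex {R : realType} {n : nat} (A : 'M[R]_n) :
  (2 < n)%N \/ A^T <> A -> ~~ is_diag_mx A -> ~ convex_set (diag_and A @` SO R n).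
Proof.
move=> hA ndA.
have [sA|nsA] := EM (A^T = A); last first.
  have [i [j Aij]] : exists i j, A j i != A i j.
    apply: contrapT => H; apply: nsA; apply/matrixP => i j; rewrite mxE.
    by apply: contrapT => /eqP Aij; apply: H; exists i, j.
  have ij : j != i by apply: contraNneq Aij => ->.
  apply: (@diag_and_nonconvex _ _ _ _ ij A (const_mx 1)) => [k|].
    by rewrite mxE expr1n.
  by rewrite big1 ?mul1r // => k _; rewrite mxE.
case: hA => // n3.
have [i [j [ij Aij]]] : exists i j, i != j /\ A i j != 0.
  apply: contrapT => H; move/negP: ndA; apply; apply/is_diag_mxP => i j ij.
  by apply: contrapT => /eqP Aij; apply: H; exists i, j.
have [k kij] := third_index i j n3.
pose d : 'rV[R]_n := \row_l (if l == k then -1 else 1).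
apply: (@diag_and_nonconvex _ _ _ _ ij A d) => [l|].
  by rewrite mxE; case: ifP; rewrite ?sqrrN expr1n.
rewrite (bigD1 k) //= big1 => [|l /andP[_ lk]]; last by rewrite mxE (negbTE lk).
have -> : A j i = A i j by rewrite -{1}sA mxE.
rewrite !mxE eqxx mulr1 mulN1r -subr_eq0 opprK.
by rewrite -mulr2n mulrn_eq0.
Qed.

(** * A nonconvex image in dimension three *)

Definition plane_functionals {R : realType} {n : nat} (i j : 'I_n) (X : 'M[R]_n) :
    'rV[R]_3 :=
  \row_k tnth [tuple \sum_(l | (l != i) && (l != j)) X l l; X i i; X i j] k.

Lemma plane_functionals_linear {R : realType} {n : nat} (i j : 'I_n) :
  linear (@plane_functionals R n i j).
Proof.
move=> a X Y; apply/rowP => k; rewrite !mxE !(tnth_nth 0).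
case: k => [[|[|[|//]]] /= _]; rewrite ?mxE // mulr_sumr -big_split.
by apply: eq_bigr => l _; rewrite !mxE.
Qed.

HB.instance Definition _ (R : realType) (n : nat) (i j : 'I_n) :=
  GRing.isLinear.Build R 'M[R]_n 'rV[R]_3 _ (@plane_functionals R n i j)
    (@plane_functionals_linear R n i j).

(* The first functional exposes a face of the convex hull that meets SO(n) in the
   rotations of the (i, j)-plane, which the other two map onto a circle. *)
Lemma SO_plane_maximally_convex {R : realType} {n : nat} : (2 < n)%N ->
  exists pi : 'Hom('M[R]_n, 'rV[R]_3), ~ convex_set (pi @` SO R n).
Proof.
move=> n3; pose i := Ordinal (ltnW (ltnW n3)); pose j := Ordinal (ltnW n3).
have ij : i != j by [].
exists (linfun (plane_functionals i j)) => cK.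
(* For x = 1 and x = -1 these are the images of the identity and of the half turn in the (i,
   j)-plane. *)
have im x : x ^+ 2 = 1 -> (linfun (plane_functionals i j) @` SO R n)
    (plane_functionals i j (signed_perm (flip i j (const_mx 1) x) 1%g)).
  move=> x1; rewrite -lfunE; exists (signed_perm (flip i j (const_mx 1) x) 1%g) => //.
  by apply: flip_SO => // k; rewrite mxE expr1n.
have := convex_mid cK (im 1 (expr1n _ _)) (im (-1) _).
rewrite sqrrN expr1n => /(_ erefl)[X [oX _]]; rewrite lfunE /= => /rowP EX.
have pfE k Y : plane_functionals i j Y 0 k =
  tnth [tuple \sum_(l | (l != i) && (l != j)) Y l l; Y i i; Y i j] k by rewrite mxE.
move: EX; set Y := signed_perm _ _; set Z := signed_perm _ _ => EX.
have {}EX k (hk : (k < 3)%N) :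
    nth 0 [:: \sum_(l | (l != i) && (l != j)) X l l; X i i; X i j] k = 2^-1 *
      (nth 0 [:: \sum_(l | (l != i) && (l != j)) Y l l; Y i i; Y i j] k +
       nth 0 [:: \sum_(l | (l != i) && (l != j)) Z l l; Z i i; Z i j] k).
  have := EX (Ordinal hk); rewrite [RHS]mxE [W in _ * W]mxE !pfE.
  by rewrite !(tnth_nth 0).
have := EX 0 isT; have := EX 1 isT; have := EX 2 isT => /=.
rewrite !signed_permE !perm1 eqxx (negbTE ij) !mulr0 !mulr1 addr0 mulr0.
have fi (x : R) : flip i j (const_mx 1) x 0 i = x by rewrite mxE eqxx.
rewrite !fi subrr mulr0.
move=> Xij Xii sX.
(* The first coordinate of the midpoint is n - 2, its largest possible value. *)
have X1 : forall l, (l != i) && (l != j) -> X l l = 1.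
  apply: (sum_diag_eq_card oX); rewrite sX.
  have E x : \sum_(l | (l != i) && (l != j))
      signed_perm (flip i j (const_mx 1) x) 1%g l l =
      \sum_(l | (l != i) && (l != j)) (1 : R).
    apply: eq_bigr => l /andP[li lj].
    by rewrite signed_permE perm1 eqxx !mxE (negbTE li) (negbTE lj) mulr1.
  by rewrite !E; lra.
(* Row i of X vanishes: at i and j by the midpoint, elsewhere because of the unit diagonal entries.
   This contradicts its norm being 1. *)
have := orth_row oX i; rewrite big1 => [/eqP|l _]; first by rewrite eq_sym oner_eq0.
have [->|li] := eqVneq l i; first by rewrite Xii expr0n.
have [->|lj] := eqVneq l j; first by rewrite Xij expr0n.
have [] := @orth_unit_diag _ _ _ oX l i; rewrite ?X1 ?li ?lj ?expr1n //.
by move=> _ ->; rewrite expr0n.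
Qed.

(** * Turning an eigenvalue -1 into 1 *)

(** As c |v|^2 = 2, the new matrix fixes v, which Y negates, and it agrees with Y on the orthogonal
    complement of v. *)
Lemma orth_add_rank1 {R : realType} {n : nat} (Y : 'M[R]_n) (v : 'rV[R]_n) (c : R) :
  Y^T *m Y = 1%:M -> v *m Y = - v -> c * (\sum_k v 0 k ^+ 2) = 2 ->
  (Y + c *: (v^T *m v))^T *m (Y + c *: (v^T *m v)) = 1%:M.
Proof.
move=> oY vY cv; set W := v^T *m v.
have WT : W^T = W by rewrite trmx_mul trmxK.
have YW : Y^T *m W = - W by rewrite mulmxA -trmx_mul vY linearN mulNmx.
have WY : W *m Y = - W by rewrite -mulmxA vY mulmxN.
have WW : W *m W = (\sum_k v 0 k ^+ 2) *: W.
  rewrite -mulmxA (mulmxA v).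
  have -> : v *m v^T = (\sum_k v 0 k ^+ 2)%:M.
    apply/matrixP => a b; rewrite !ord1 !mxE mulr1n.
    by apply: eq_bigr => k _; rewrite mxE expr2.
  by rewrite mul_scalar_mx scalemxAr.
have -> : (Y + c *: W)^T = Y^T + c *: W by rewrite linearD linearZ /= WT.
rewrite mulmxDl !mulmxDr -!scalemxAl -!scalemxAr oY YW WY WW.
move: (\sum_k _) cv => s cv; clearbody W; apply/matrixP => i j; rewrite !mxE.
rewrite (_ : c * (c * (s * W i j)) = c * s * (c * W i j)); last by ring.
by rewrite cv; ring.
Qed.

Lemma orth_det_sqr {R : realType} {n : nat} {X : 'M[R]_n} :
  X^T *m X = 1%:M -> \det X ^+ 2 = 1.
Proof. by move=> oX; rewrite expr2 -{1}det_tr -det_mulmx oX det1. Qed.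

(* det (1 + Y) = det Y * det (Y^T + 1) = - det (1 + Y), so -1 is an eigenvalue of
   Y; replacing it by 1 keeps the matrix orthogonal and increases the trace by 2. *)
Lemma orth_det_neg {R : realType} {n : nat} {Y : 'M[R]_n} :
  Y^T *m Y = 1%:M -> \det Y = -1 ->
  exists (v : 'rV[R]_n) (c : R), let Y' := Y + c *: (v^T *m v) in
    Y'^T *m Y' = 1%:M /\ \tr Y' = \tr Y + 2.
Proof.
move=> oY dY; have /eqP/det0P[v v0 vY] : \det (Y + 1%:M) = 0.
  have : \det (Y + 1%:M) = - \det (Y + 1%:M); last by lra.
  have {1}-> : Y + 1%:M = Y *m (Y + 1%:M)^T.
    by rewrite linearD /= trmx1 mulmxDr mulmx1 (mulmx1C oY) addrC.
  by rewrite det_mulmx det_tr dY mulN1r.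
have s0 : \sum_k v 0 k ^+ 2 != 0.
  apply: contra_neq v0 => s0; apply/rowP => k; rewrite mxE; apply/eqP.
  by rewrite -sqrf_eq0 (psumr_eq0P _ s0) // => l _; apply: sqr_ge0.
pose c := 2 / \sum_k v 0 k ^+ 2.
have cv : c * \sum_k v 0 k ^+ 2 = 2 by rewrite divfK.
exists v, c; split.
  apply: orth_add_rank1 => //.
  by move/eqP: vY; rewrite mulmxDr mulmx1 addr_eq0 => /eqP.
rewrite linearD linearZ /=; congr (_ + _); rewrite -cv; congr (_ * _).
by apply: eq_bigr => k _; rewrite mxE big_ord1 mxE expr2.
Qed.

(** * The gap between SO(n) and its convex hull *)

(** Takes the place of compactness for the maximum over SO(n): with the chosen upper entries the
    objective has finitely many values. *)
Lemma finite_is_max {R : realType} (T : finType) (F : T -> R) (A : set R) :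
  A !=set0 -> (forall a, A a -> exists t, a = F t) -> exists m, is_max A m.
Proof.
move=> [a Aa] AF; have [t0 at0] := AF a Aa.
have A0 : `[<A (F t0)>] by apply/asboolP; rewrite -at0.
case: (@arg_maxP _ _ _ t0 (fun t => `[<A (F t)>]) F A0) => t /asboolP At tmax.
exists (F t); split=> // b Ab; have [u bu] := AF b Ab.
by rewrite bu; apply: tmax; apply/asboolP; rewrite -bu.
Qed.

Lemma frobD {R : realType} {n : nat} (A X Y : 'M[R]_n) (a b : R) :
  frob A (a *: X + b *: Y) = a * frob A X + b * frob A Y.
Proof. by rewrite /frob mulmxDr -!scalemxAr linearD !linearZ. Qed.

Section NegativeDet.
Context {R : realType} {n : nat} (n3 : (2 < n)%N).

Let i0 := Ordinal (ltnW (ltnW n3)).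
Let i1 := Ordinal (ltnW n3).
Let i2 := Ordinal n3.

Let C : 'M[R]_n := diag_mx (\row_k (if k == i0 then -1 else 1)).

Let C1 : C^T *m C = 1%:M.
Proof.
by apply: diag_sign_orth => k; rewrite mxE; case: ifP; rewrite ?sqrrN expr1n.
Qed.

Let detC : \det C = -1.
Proof.
rewrite det_diag (bigD1 i0) //= big1 => [|k k0]; first by rewrite mxE eqxx mulr1.
by rewrite mxE (negbTE k0).
Qed.

Let CX_orth X : SO R n X -> (C *m X)^T *m (C *m X) = 1%:M.
Proof. by move=> [oX _]; rewrite trmx_mul -mulmxA (mulmxA C^T) C1 mul1mx. Qed.

Let frobC X : frob C X = \tr (C *m X).
Proof. by rewrite /frob tr_diag_mx. Qed.

Let tr_orth_le (Y : 'M[R]_n) : Y^T *m Y = 1%:M -> \tr Y <= n%:R.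
Proof.
move=> oY; have -> : n%:R = \sum_(k < n) (1 : R) by rewrite sumr_const card_ord.
by apply: ler_sum => k _; apply: le_trans (ler_norm _) (orth_entry_le1 oY k k).
Qed.

(** [C *m X] is orthogonal of determinant -1, so its trace can be raised by 2 within the orthogonal
    matrices, where it is at most n. *)
Let frobC_SO_le X : SO R n X -> frob C X <= n%:R - 2.
Proof.
move=> SX; have [oX dX] := SX.
have [|v [c [oY tY]]] := orth_det_neg (CX_orth _ SX).
  by rewrite det_mulmx detC dX mulr1.
by have := tr_orth_le _ oY; rewrite tY -frobC; lra.
Qed.

Let frobC_SO_eq X : SO R n X -> frob C X = n%:R - 2 ->
  X i1 i2 = 0 -> X i0 i1 = 0 \/ X i0 i2 = 0.
Proof.
move=> SX; have [oX dX] := SX.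
have [|v [c [oY tY]]] := orth_det_neg (CX_orth _ SX).
  by rewrite det_mulmx detC dX mulr1.
rewrite frobC => tX X12.
(* The modified matrix has trace n, hence unit diagonal and zero off-diagonal entries: the entries
   of [C *m X] off the diagonal are those of - c v^T v. *)
have Y1 k : (C *m X + c *: (v^T *m v)) k k = 1.
  apply: (@sum_diag_eq_card _ _ _ oY xpredT _ k isT).
  by rewrite -/(\tr _) tY tX sumr_const card_ord; lra.
have Xe (i j : 'I_n) : i != j -> C i i * X i j = - (c * (v 0 i * v 0 j)).
  move=> ij; have [|+ _] := orth_unit_diag oY i j _ ij; first by rewrite Y1 expr1n.
  rewrite mxE mul_diag_mx !mxE big_ord1 !mxE eqxx mulr1n => /eqP.
  by rewrite addr_eq0 => /eqP.
have := Xe i1 i2 isT; have := Xe i0 i1 isT; have := Xe i0 i2 isT.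
rewrite X12 !mxE eqxx /= !mulr1n mulr0 => E02 E01 /esym/eqP.
rewrite oppr_eq0 !mulf_eq0 => /or3P[] /eqP z.
- by left; move: E01; rewrite z; lra.
- by left; move: E01; rewrite z; lra.
- by right; move: E02; rewrite z; lra.
Qed.

(** A quarter turn in the (i0, j)-plane. Like the identity it attains the bound n - 2, and its only
    nonzero entry above the diagonal is at (i0, j). *)
Let P j : 'M[R]_n :=
  signed_perm (\row_k (if k == j then -1 else 1)) (tperm i0 j).

Let P_SO j : j != i0 -> SO R n (P j).
Proof.
move=> j0; apply: signed_perm_SO => [k|].
  by rewrite mxE; case: ifP; rewrite ?sqrrN expr1n.
rewrite odd_tperm eq_sym j0 expr1 (bigD1 j) //= big1 => [|k kj].
  by rewrite mxE eqxx mulr1 mulrNN mulr1.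
by rewrite mxE (negbTE kj).
Qed.

Let P_upper (j k l : 'I_n) : (k < l)%N -> P j k l = ((k == i0) && (l == j))%:R.
Proof.
move=> kl; have nkl : k != l by apply: contraTneq kl => ->; rewrite ltnn.
rewrite signed_permE mxE; case: tpermP => [k0|kj|/eqP k0 /eqP kj].
- rewrite k0 eqxx /= (eq_sym l); case: (eqVneq j l) => [jl|_]; last by rewrite mulr0.
  by rewrite -k0 jl (negbTE nkl) mul1r.
- rewrite [i0 == l](_ : _ = false) ?mulr0; last first.
    by apply/eqP => l0; move: kl; rewrite -l0 ltn0.
  by rewrite -kj (eq_sym l) (negbTE nkl) andbF.
- by rewrite (negbTE k0) (negbTE nkl) mulr0.
Qed.

Let frobC_P j : j != i0 -> frob C (P j) = n%:R - 2.
Proof.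
move=> j0; rewrite frob_signed_perm (bigD1 i0) //= (bigD1 j) //=.
rewrite tpermL tpermR !mxE !(negbTE j0) eq_sym (negbTE j0) !mulr0n !mul0r !add0r.
rewrite (eq_bigr (fun=> 1)) => [|k /andP[k0 kj]].
  have -> : n%:R = 1 + (1 + \sum_(k | (k != i0) && (k != j)) 1) :> R.
    by rewrite -[in LHS](card_ord n) -sumr_const (bigD1 i0) //= (bigD1 j).
  by lra.
by rewrite tpermD 1?eq_sym // !mxE eqxx (negbTE k0) (negbTE kj) mulr1.
Qed.

Let frobC_1 : frob C 1%:M = n%:R - 2.
Proof.
rewrite frobC mulmx1 mxtrace_diag (bigD1 i0) //= (eq_bigr (fun=> 1)) => [|k k0].
  have -> : n%:R = 1 + \sum_(k | k != i0) 1 :> R.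
    by rewrite -[in LHS](card_ord n) -sumr_const (bigD1 i0).
  by rewrite mxE eqxx; lra.
by rewrite mxE (negbTE k0).
Qed.

(** From the triples (3, 4, 5) and (5, 12, 13): x = (4/5)(5/13) and y = 3/5. This makes x + y < 1
    and keeps the diagonal of every feasible orthogonal matrix rational. *)
Let x : R := 4 / 13.
Let y : R := 3 / 5.

(** The maximizers [P i1], [P i2] and 1 with weights x, y and 1 - x - y, since 13/15 = y / (1 -
    x). *)
Let Z : 'M[R]_n := x *: P i1 + (1 - x) *: ((13 / 15) *: P i2 + (1 - 13 / 15) *: 1%:M).

Let Z_upper (k l : 'I_n) : (k < l)%N ->
  Z k l = x * ((k == i0) && (l == i1))%:R + y * ((k == i0) && (l == i2))%:R.
Proof.
move=> kl; have nkl : k != l by apply: contraTneq kl => ->; rewrite ltnn.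
have ZE : Z k l = x * P i1 k l + (1 - x) * (13 / 15 * P i2 k l +
    (1 - 13 / 15) * (1%:M : 'M[R]_n) k l).
  rewrite /Z; move: (P i1) (P i2) => P1 P2.
  by rewrite !mxE.
rewrite ZE !P_upper // mxE (negbTE nkl) mulr0n /y /x.
by field.
Qed.

Let Z_hull : conv_hull (SO R n) Z.
Proof.
have SO1 : SO R n 1%:M by split; rewrite ?trmx1 ?mulmx1 ?det1.
move=> D [/convex_setE cD SD]; apply: (cD); rewrite /x; try lra.
  exact/SD/P_SO.
apply: cD; try lra; last exact: SD.
exact/SD/P_SO.
Qed.

Let frobC_Z : frob C Z = n%:R - 2.
Proof. by rewrite !frobD !frobC_P // frobC_1; ring. Qed.

Let frobC_hull_le X : conv_hull (SO R n) X -> frob C X <= n%:R - 2.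
Proof.
move=> HX; apply: (HX [set X | frob C X <= n%:R - 2]); split=> //=.
apply/convex_setE => A B t t0 t1 /= hA hB; rewrite frobD.
have -> : n%:R - 2 = t * (n%:R - 2) + (1 - t) * (n%:R - 2) :> R by ring.
by apply: lerD; apply: ler_wpM2l => //; rewrite subr_ge0.
Qed.

(** The upper entries determine the diagonal up to signs, so [frob C] takes finitely many values on
    the feasible set. *)
Let SO_Z_diag X : X^T *m X = 1%:M -> upper_proj X = upper_proj Z ->
  forall k, X k k ^+ 2 = (if k == i0 then 48 / 65 else if k == i1 then 12 / 13
    else if k == i2 then 4 / 5 else 1) ^+ 2.
Proof.
move=> oX XZ.
have XE (k l : 'I_n) : (k < l)%N -> X k l =
    x * ((k == i0) && (l == i1))%:R + y * ((k == i0) && (l == i2))%:R.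
  move=> kl; rewrite -Z_upper //.
  by have /ffunP/(_ (exist _ (k, l) kl)) := XZ; rewrite !ffunE.
have X3 (k : 'I_n) : (2 < k)%N -> X k k ^+ 2 = 1.
  (* Induction from the last column backwards: in column k the entries above the diagonal are
     prescribed to be 0, and those below vanish because later diagonal entries have square 1. *)
  have [m] := ubnP (n - k)%N; elim: m k => // m IH k km k2.
  rewrite -[RHS](orth_col oX k) (bigD1 k) //= big1 ?addr0 // => l lk.
  case: (ltngtP l k) => [lk'|kl|/val_inj E]; last by rewrite E eqxx in lk.
    have nk (i : 'I_n) : (i < 3)%N -> (k == i) = false.
      by move=> i3; apply: contraTF k2 => /eqP->; rewrite -leqNgt.
    by rewrite XE // !nk // !andbF !mulr0 addr0 expr0n.
  have [] := @orth_unit_diag _ _ _ oX l k.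
  - apply: IH; last exact: ltn_trans kl.
    by rewrite -ltnS; apply: leq_trans km; rewrite ltnS ltn_sub2l // ltn_ord.
  - by rewrite neq_ltn kl orbT.
  - by move=> ->; rewrite expr0n.
have sum3 (F : 'I_n -> R) : (forall k : 'I_n, (2 < k)%N -> F k = 0) ->
    \sum_k F k = F i0 + F i1 + F i2.
  move=> F0; rewrite (bigD1 i0) //= (bigD1 i1) //= (bigD1 i2) //= big1.
    by rewrite addr0 !addrA.
  case=> [[|[|[|k]]]] kn // _; exact: F0.
have X30 (k l : 'I_n) : (2 < k)%N -> (l < 3)%N -> X l k = 0 /\ X k l = 0.
  move=> k2 l3; have [] := @orth_unit_diag _ _ _ oX k l; rewrite ?X3 //.
  by rewrite neq_ltn (leq_trans l3) ?orbT.
have X01 : X i0 i1 = x by rewrite XE //= mulr1 mulr0 addr0.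
have X02 : X i0 i2 = y by rewrite XE //= mulr1 mulr0 add0r.
have X12 : X i1 i2 = 0 by rewrite XE //= !mulr0 addr0.
have E2 : X i2 i2 ^+ 2 = (4 / 5) ^+ 2.
  have := orth_col oX i2; rewrite sum3 => [|k k2]; last first.
    by rewrite (proj2 (X30 k i2 k2 _)) // expr0n.
  by rewrite X02 X12 /y => E; lra.
have E0 : X i0 i0 ^+ 2 = (48 / 65) ^+ 2.
  have := orth_row oX i0; rewrite sum3 => [|k k2]; last first.
    by rewrite (proj1 (X30 k i0 k2 _)) // expr0n.
  by rewrite X01 X02 /y /x => E; lra.
have E1 : X i1 i1 ^+ 2 = (12 / 13) ^+ 2.
  have := orth_row oX i1; rewrite sum3 => [|k k2]; last first.
    by rewrite (proj1 (X30 k i1 k2 _)) // expr0n.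
  rewrite X12 => E.
  (* Orthogonality of rows i0 and i1 relates [X i1 i0] to [X i1 i1], and the norm of row i1 then
     fixes the latter up to sign. *)
  have : \sum_k X i0 k * X i1 k = 0.
    have /matrixP/(_ i0 i1) := mulmx1C oX; rewrite !mxE mulr0n => H; rewrite -[RHS]H.
    by apply: eq_bigr => k _; rewrite mxE.
  rewrite sum3 => [|k k2]; last by rewrite (proj1 (X30 k i0 k2 _)) // mul0r.
  rewrite X12 X01 mulr0 addr0 => /eqP; rewrite addr_eq0 => /eqP F.
  have : X i0 i0 ^+ 2 * X i1 i0 ^+ 2 = x ^+ 2 * X i1 i1 ^+ 2.
    by rewrite -!exprMn F sqrrN.
  by rewrite E0 /x; lra.
move=> k; case: eqP => [->|/eqP k0] //; case: eqP => [->|/eqP k1] //.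
case: eqP => [->|/eqP k2] //; rewrite expr1n; apply: X3.
by case: k k0 k1 k2 => [[|[|[|k]]]].
Qed.

(* Product of the reflections along e_0 - 3 e_2 and e_0 - 5 e_1; negating its row
   i2, which has no entry above the diagonal, corrects the determinant. *)
Let SO_Z_nonempty : exists2 X, SO R n X & upper_proj X = upper_proj Z.
Proof.
pose vec (a b : R) : 'rV[R]_n := \row_k (if k == i0 then 1 else if k == i1 then a
  else if k == i2 then b else 0).
(* Minus a reflection when c |vec a b|^2 = 2, in the form that [orth_add_rank1] yields from Y = -1.
   The signs cancel in [U *m V]. *)
pose H (a b c : R) : 'M[R]_n := (-1)%:M + c *: ((vec a b)^T *m vec a b).
have oH a b c : c * (1 + a ^+ 2 + b ^+ 2) = 2 -> (H a b c)^T *m H a b c = 1%:M.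
  move=> hc; apply: orth_add_rank1.
  - by rewrite tr_scalar_mx -scalar_mxM mulrNN mulr1.
  - by rewrite mul_mx_scalar scaleN1r.
  - rewrite (bigD1 i0) //= (bigD1 i1) //= (bigD1 i2) //=.
    rewrite big1 => [|k /andP[/andP[k0 k1] k2]].
      by rewrite !mxE /= -hc; ring.
    by rewrite mxE (negbTE k0) (negbTE k1) (negbTE k2) expr0n.
pose U := H 0 (-3) (1 / 5); pose V := H (-5) 0 (1 / 13); pose X := U *m V.
have oX : X^T *m X = 1%:M.
  rewrite trmx_mul -mulmxA (mulmxA U^T) oH ?mul1mx; last by field.
  by apply: oH; field.
have XZ (k l : 'I_n) : (k < l)%N -> X k l = Z k l.
  move=> kl; rewrite Z_upper //.
  pose u := vec 0 (-3); pose v := vec (-5) 0.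
  (* The two vectors overlap only at i0, where both are 1; this collapses the product of the
     rank-one terms. *)
  have uv : u *m v^T = 1%:M.
    apply/matrixP => a b; rewrite !ord1 !mxE (bigD1 i0) //= (bigD1 i1) //=.
    rewrite (bigD1 i2) //= big1 => [|i /andP[/andP[ki0 ki1] ki2]].
      by rewrite !mxE /=; ring.
    by rewrite !mxE (negbTE ki0) (negbTE ki1) (negbTE ki2) mul0r.
  have -> : X = 1%:M - (1 / 5) *: (u^T *m u) - (1 / 13) *: (v^T *m v) +
      (1 / 5 * (1 / 13)) *: (u^T *m v).
    rewrite /X /U /V /H -/u -/v mulmxDl !mulmxDr -!scalemxAl -!scalemxAr.
    rewrite (mulmxA (u^T *m u) v^T) -(mulmxA u^T u v^T) uv mulmx1.
    rewrite -scalar_mxM mulrNN mulr1 !mul_scalar_mx mul_mx_scalar.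
    move: (u^T *m u) (v^T *m v) (u^T *m v) => A1 A2 A3; apply/matrixP => i j.
    by rewrite !mxE; move: (1 *+ _) => d; ring.
  have nkl : k != l by apply: contraTneq kl => ->; rewrite ltnn.
  rewrite !mxE !big_ord1 !mxE (negbTE nkl) mulr0n /x /y.
  by case: l k kl {nkl} => [[|[|[|l]]] hl] [[|[|[|k]]] hk] //= _; field.
(* [\det X] is a sign, so scaling a row by it makes the determinant its square, 1. *)
clearbody X; pose e : 'rV[R]_n := \row_k (if k == i2 then \det X else 1).
have e1 k : e 0 k ^+ 2 = 1.
  by rewrite mxE; case: ifP => _; rewrite ?expr1n ?orth_det_sqr.
exists (diag_mx e *m X); [split|].
- by rewrite trmx_mul -mulmxA (mulmxA (diag_mx e)^T) diag_sign_orth // mul1mx.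
- rewrite det_mulmx det_diag (bigD1 i2) //= big1 => [|k k2].
    by rewrite mxE eqxx mulr1 -expr2 orth_det_sqr.
  by rewrite mxE (negbTE k2).
apply/ffunP => -[[k l] /= kl]; rewrite !ffunE /= mul_diag_mx mxE XZ // Z_upper //.
rewrite mxE; case: (eqVneq k i2) => [->|_]; last by rewrite mul1r.
by rewrite /= !mulr0 addr0 mulr0.
Qed.

Lemma SO_relaxation_gap : exists (sigma : {ffun upper_idx n -> R}) (C : 'M[R]_n)
    (m1 m2 : R), [/\ is_diag_mx C,
  is_max [set frob C X | X in SO R n `&` [set X | upper_proj X = sigma]] m1,
  is_max [set frob C X | X in
    conv_hull (SO R n) `&` [set X | upper_proj X = sigma]] m2
  & m1 < m2].
Proof.
pose q (k : 'I_n) : R := if k == i0 then 48 / 65 else if k == i1 then 12 / 13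
  else if k == i2 then 4 / 5 else 1.
(* [s] records which diagonal entries are negative. *)
pose F (s : {ffun 'I_n -> bool}) :=
  \sum_k (if k == i0 then -1 else 1) * ((-1) ^+ s k * q k).
have [||m1 M1] := @finite_is_max R _ F
  [set frob C X | X in SO R n `&` [set X | upper_proj X = upper_proj Z]].
- by have [X SX XZ] := SO_Z_nonempty; exists (frob C X), X.
- move=> _ [X [[oX _] XZ] <-]; exists [ffun k => X k k != q k].
  rewrite frobC; apply: eq_bigr => k _; rewrite mul_diag_mx !mxE ffunE.
  congr (_ * _); have /eqP := SO_Z_diag _ oX XZ k; rewrite -/(q k) eqf_sqr.
  case: (eqVneq (X k k) (q k)) => [-> _|_ /= /eqP ->]; first by rewrite mul1r.
  by rewrite expr1 mulN1r.
exists (upper_proj Z), C, m1, (n%:R - 2); split=> //.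
- exact: diag_mx_is_diag.
- split; first by exists Z => //; exact: frobC_Z.
  by move=> _ [X [HX _] <-]; exact: frobC_hull_le.
(* The value of [m1] stays unknown; its maximizer cannot reach n - 2, because x and y are both
   nonzero while the (i1, i2) entry is 0. *)
have [[X [SX XZ] <-] _] := M1.
rewrite lt_neqAle frobC_SO_le // andbT; apply/eqP => E.
have XE (k l : 'I_n) (kl : (k < l)%N) : X k l = Z k l.
  by have /ffunP/(_ (exist _ (k, l) kl)) := XZ; rewrite !ffunE.
have := frobC_SO_eq _ SX E; rewrite !XE // !Z_upper //= /x /y.
by case; lra.
Qed.

End NegativeDet.

(** * Covering SO(n) by small cells and counting dimensions *)

(* With A = U - 1 and B = V - 1 small, Z = U - V satisfies
   Z + Z^T = - (A^T Z + Z^T B), so Z is skew up to a small multiple of itself and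
   its entries above the diagonal control it. *)
Lemma orth_near1_upper {R : realType} {n : nat} {U V : 'M[R]_n} {e d : R} :
  U^T *m U = 1%:M -> V^T *m V = 1%:M ->
  (forall i j, `|(U - 1%:M) i j| <= e) -> (forall i j, `|(V - 1%:M) i j| <= e) ->
  4 * n%:R * e <= 1 -> 0 <= d ->
  (forall i j : 'I_n, (i < j)%N -> `|(U - V) i j| <= d) ->
  \sum_i \sum_j `|(U - V) i j| <= 2 * n%:R ^+ 2 * d.
Proof.
move=> oU oV; set A := U - 1%:M; set B := V - 1%:M; set Z := U - V.
move=> Ae Be ne d0 Zd.
have ZT : Z + Z^T = - (A^T *m Z + Z^T *m B).
  rewrite /A /B /Z !linearB /= trmx1 !mulmxBl !mul1mx !mulmx1 oU oV.
  move: (U^T *m V) (U^T) (V^T) => W U' V'; apply/matrixP => i j.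
  by rewrite !mxE; move: (1 *+ _) => x; ring.
clearbody Z A B.
have skew i j : `|Z i j + Z j i| <= e * \sum_k (`|Z k j| + `|Z k i|).
  have -> : Z i j + Z j i = (Z + Z^T) i j by rewrite !mxE.
  rewrite ZT !mxE normrN -big_split mulr_sumr /=.
  apply: le_trans (ler_norm_sum _ _ _) (ler_sum _ _) => k _; rewrite !mxE.
  apply: le_trans (ler_normD _ _) _; rewrite !normrM mulrDr; apply: lerD.
    exact: ler_wpM2r.
  by rewrite mulrC; apply: ler_wpM2r.
have entry i j : `|Z i j| <= d + e * \sum_k (`|Z k j| + `|Z k i|).
  case: (ltngtP i j) => [ij|ji|/val_inj ij].
  - apply: le_trans (Zd _ _ ij) _; rewrite lerDl.
    exact: le_trans (normr_ge0 _) (skew i j).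
  - have -> : Z i j = Z i j + Z j i - Z j i by rewrite addrK.
    apply: le_trans (ler_normB _ _) _; rewrite (addrC d); apply: lerD => //.
    exact: Zd.
  - have := skew i i; rewrite -ij -mulr2n normrMn mulr2n.
    by have := normr_ge0 (Z i i); lra.
set N := \sum_i \sum_j `|Z i j|.
have N0 : 0 <= N by apply: sumr_ge0 => i _; apply: sumr_ge0.
(* As 4 n e <= 1, the last term is at most N / 2 and is absorbed on the left. *)
have Nle : N <= n%:R ^+ 2 * d + 2 * n%:R * e * N.
  have sN : \sum_j \sum_k `|Z k j| = N by rewrite exchange_big.
  have inner i : \sum_j (d + e * \sum_k (`|Z k j| + `|Z k i|)) =
      n%:R * d + e * (N + n%:R * \sum_k `|Z k i|).
    rewrite big_split /= sumr_const card_ord -mulr_sumr !mulr_natl.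
    under [\sum_(_ < n) \sum_(_ < n) _]eq_bigr => j _ do rewrite big_split /=.
    by rewrite big_split /= sN sumr_const card_ord.
  apply: le_trans (ler_sum _ _) _ => [i _|].
    by apply: ler_sum => j _; exact: entry.
  rewrite (eq_bigr _ (fun i _ => inner i)) big_split /= sumr_const card_ord.
  rewrite -mulr_sumr big_split /= sumr_const card_ord -mulr_sumr sN.
  by clearbody N; rewrite le_eqVlt; apply/orP; left; apply/eqP; ring.
have : 4 * n%:R * e * N <= 1 * N by apply: ler_wpM2r.
by clearbody N; move: Nle; rewrite mul1r; lra.
Qed.

(** Multiplication by [X0^T] moves X and Y near 1, at the price of a factor n in the entrywise
    distance. Multiplying back bounds an entry of X - Y by the sum of all entries of the moved
    difference in absolute value. *)
Lemma orth_near_upper {R : realType} {n : nat} {X0 X Y : 'M[R]_n} {h d : R} :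
  X0^T *m X0 = 1%:M -> X^T *m X = 1%:M -> Y^T *m Y = 1%:M ->
  (forall i j, `|X i j - X0 i j| <= h) -> (forall i j, `|Y i j - X0 i j| <= h) ->
  4 * n%:R ^+ 2 * h <= 1 -> 0 <= d ->
  (forall i j : 'I_n, (i < j)%N ->
    `|(X0^T *m X) i j - (X0^T *m Y) i j| <= d) ->
  forall i j, `|X i j - Y i j| <= 2 * n%:R ^+ 2 * d.
Proof.
move=> o0 oX oY Xh Yh nh d0 XYd i j.
have o0' := mulmx1C o0.
have orthM (W : 'M[R]_n) : W^T *m W = 1%:M -> (X0^T *m W)^T *m (X0^T *m W) = 1%:M.
  by move=> oW; rewrite trmx_mul trmxK -mulmxA (mulmxA X0) o0' mul1mx.
have nearM (W : 'M[R]_n) : (forall i j, `|W i j - X0 i j| <= h) ->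
    forall i j, `|(X0^T *m W - 1%:M) i j| <= n%:R * h.
  move=> Wh k l; rewrite -o0 -mulmxBr mxE -[n in n%:R]card_ord mulr_natl -sumr_const.
  apply: le_trans (ler_norm_sum _ _ _) (ler_sum _ _) => m _.
  rewrite !mxE normrM -[h]mul1r; apply: ler_pM => //; exact: orth_entry_le1.
have XYE : X i j - Y i j = \sum_k X0 i k * (X0^T *m X - X0^T *m Y) k j.
  have -> : X i j - Y i j = (X - Y) i j by rewrite !mxE.
  by rewrite -[X - Y]mul1mx -o0' -mulmxA mulmxBr mxE.
apply: le_trans (orth_near1_upper (orthM X oX) (orthM Y oY) (nearM X Xh)
  (nearM Y Yh) _ d0 _); last 2 first.
- by move: nh; rewrite expr2; lra.
- move=> k l kl; have := XYd k l kl.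
  by move: (X0^T *m X) (X0^T *m Y) => P Q; rewrite !mxE.
rewrite XYE [leRHS]exchange_big [leRHS](bigD1 j) //=.
apply: ler_wpDr; first by apply: sumr_ge0 => l _; apply: sumr_ge0.
apply: le_trans (ler_norm_sum _ _ _) (ler_sum _ _) => k _.
by rewrite normrM -[leRHS]mul1r; apply: ler_wpM2r => //; exact: orth_entry_le1.
Qed.

(** Cells of width 1/N on [-1, 1]; the extra index 2N is that of the endpoint 1. *)
Definition grid_cell {R : realType} (N : nat) (x : R) : 'I_(2 * N).+1 :=
  inord (Num.truncn ((x + 1) * N%:R)).

Lemma grid_cell_near {R : realType} (N : nat) (x y : R) : (0 < N)%N ->
  `|x| <= 1 -> `|y| <= 1 -> grid_cell N x = grid_cell N y -> `|x - y| <= N%:R^-1.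
Proof.
move=> N0 x1 y1 /(congr1 val) /=.
have N0' : 0 < N%:R :> R by rewrite ltr0n.
have bnd (z : R) : `|z| <= 1 -> 0 <= (z + 1) * N%:R <= (2 * N)%:R.
  rewrite ler_norml => /andP[z0 z1]; apply/andP; split.
    by apply: mulr_ge0; lra.
  by rewrite natrM; apply: ler_wpM2r; lra.
have cell (z : R) : `|z| <= 1 -> (Num.truncn ((z + 1) * N%:R) < (2 * N).+1)%N.
  by move=> /bnd/andP[z0 zN]; rewrite ltnS -(ler_nat R) (le_trans _ zN) // truncn_le.
rewrite !inordK ?cell // => E.
have /andP[+ _] := bnd x x1 => /truncn_itv /andP[].
have /andP[+ _] := bnd y y1 => /truncn_itv /andP[].
rewrite E -!natr1 => a1 a2 b1 b2.
rewrite -(ler_pM2r N0') mulVf ?gt_eqF // -[N%:R in leLHS]gtr0_norm // -normrM.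
by rewrite ler_norml; apply/andP; split; lra.
Qed.

(* The first component of a cell locates X coarsely; the second one locates the
   entries above the diagonal of X0^T X, for a representative X0 of the first. *)
Lemma orth_cover (R : realType) (n : nat) : exists K : nat, forall N : nat, (0 < N)%N ->
  exists (T : finType) (f : 'M[R]_n -> T),
    (#|T| <= K * (2 * N).+1 ^ 'C(n, 2))%N /\
    forall X Y, X^T *m X = 1%:M -> Y^T *m Y = 1%:M -> f X = f Y ->
      forall i j, `|X i j - Y i j| <= 2 * n%:R ^+ 2 / N%:R.
Proof.
(* Coarse cells of width 1/J meet the smallness condition 4 n^2 h <= 1 of [orth_near_upper]. Their
   number does not depend on N. *)
pose J := (4 * n ^ 2).+1.
exists #|{ffun 'I_n * 'I_n -> 'I_(2 * J).+1}| => N N0.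
pose coarse (X : 'M[R]_n) := [ffun p : 'I_n * 'I_n => grid_cell J (X p.1 p.2)].
(* The default 0 arises only for cells without orthogonal matrices. *)
pose rep c := xget 0 [set X | X^T *m X = 1%:M /\ coarse X = c].
pose fine (X : 'M[R]_n) := [ffun p : upper_idx n =>
  grid_cell N (((rep (coarse X))^T *m X) (val p).1 (val p).2)].
exists ({ffun 'I_n * 'I_n -> 'I_(2 * J).+1} * {ffun upper_idx n -> 'I_(2 * N).+1})%type.
exists (fun X => (coarse X, fine X)); split.
  by rewrite card_prod [X in (_ * X)%N]card_ffun card_upper_idx card_ord.
move=> X Y oX oY [cXY fXY]; set X0 := rep (coarse X).
have [o0 c0] : X0^T *m X0 = 1%:M /\ coarse X0 = coarse X.
  by apply: (xgetPex 0 (P := [set Z | Z^T *m Z = 1%:M /\ coarse Z = coarse X])); exists X.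
have near (Z : 'M[R]_n) : Z^T *m Z = 1%:M -> coarse X0 = coarse Z ->
    forall i j, `|Z i j - X0 i j| <= J%:R^-1.
  move=> oZ /ffunP cZ i j; have := cZ (i, j); rewrite !ffunE /= => cij.
  by apply: grid_cell_near; rewrite // orth_entry_le1.
apply: (orth_near_upper o0 oX oY (near X oX c0) (near Y oY _)).
- by rewrite c0.
- rewrite ler_pdivrMr ?ltr0n // mul1r -natrX -natrM ler_nat; exact: leqnSn.
- by rewrite invr_ge0 ler0n.
move=> i j ij; have oM (W : 'M[R]_n) :
    W^T *m W = 1%:M -> (X0^T *m W)^T *m (X0^T *m W) = 1%:M.
  by move=> oW; rewrite trmx_mul trmxK -mulmxA (mulmxA X0) (mulmx1C o0) mul1mx.
apply: grid_cell_near => //; try exact: orth_entry_le1 (oM _ _) _ _.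
by have /ffunP/(_ (exist _ (i, j) ij)) := fXY; rewrite !ffunE /= -cXY.
Qed.

(* SO(n) is covered by O(N^'C(n, 2)) cells of diameter O(1/N), whereas a convex
   image contains a parallelepiped of dimension \dim (limg pi), hence a grid of
   (N/c)^(\dim (limg pi)) points separated by more than the image of a cell. *)
Lemma SO_rank_nonconvex {R : realType} {n m : nat} (pi : 'Hom('M[R]_n, 'rV[R]_m)) :
  (2 < n)%N -> ('C(n, 2) < \dim (limg pi))%N -> ~ convex_set (pi @` SO R n).
Proof.
move=> n3 rank_pi /convex_image cK; set r : nat := \dim (limg pi) in rank_pi.
have [K cover] := orth_cover R n.
pose b := vbasis (limg pi); pose u i : 'M[R]_n := (pi^-1)%VF b`_i.
pose phi (i : 'I_r) (M : 'M[R]_n) : R := coord b i (pi M).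
have phi_u (i j : 'I_r) : phi i (u j) = (i == j)%:R.
  rewrite /phi /u limg_lfunVK; last first.
    by apply: vbasis_mem; apply: mem_nth; rewrite size_tuple.
  by rewrite coord_free 1?eq_sym //; apply: basis_free (vbasisP _).
pose Phi : R := \sum_i \sum_k \sum_l `|phi i (delta_mx k l)|.
have phi_le (i : 'I_r) (M : 'M[R]_n) (e : R) :
    (forall k l, `|M k l| <= e) -> `|phi i M| <= Phi * e.
  move=> Me; rewrite {1}[M]matrix_sum_delta /phi !linear_sum /=.
  apply: (@le_trans _ _ (\sum_k \sum_l `|phi i (delta_mx k l)| * e)).
    apply: le_trans (ler_norm_sum _ _ _) (ler_sum _ _) => k _.
    rewrite !linear_sum; apply: le_trans (ler_norm_sum _ _ _) (ler_sum _ _) => l _.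
    by rewrite !linearZ /= normrM mulrC; apply: ler_wpM2l.
  under eq_bigr do rewrite -mulr_suml; rewrite -mulr_suml.
  have [n0|] := posnP n; first by rewrite n0 in n3.
  move=> n0; apply: ler_wpM2r.
    exact: le_trans (normr_ge0 _) (Me (Ordinal n0) (Ordinal n0)).
  rewrite /Phi (bigD1 i) //= lerDl; apply: sumr_ge0 => j _.
  by apply: sumr_ge0 => k _; apply: sumr_ge0.
(* Dividing by [s] puts the grid spanned by the [u i] into the l1 ball. *)
pose s : R := 1 + \sum_(i < r) \sum_k \sum_l `|u i k l|.
have s1 : 1 <= s.
  by rewrite lerDl; apply: sumr_ge0 => i _; apply: sumr_ge0 => k _; apply: sumr_ge0.
have s0 : 0 < s by apply: lt_le_trans s1.
have Phi0 : 0 <= Phi.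
  by apply: sumr_ge0 => i _; apply: sumr_ge0 => k _; apply: sumr_ge0.
(* Chosen so that with N = G c the coordinates [phi i] vary over a cell by at most Phi 2 n^2 / N < 1
   / (G s), the spacing of the grid. *)
pose c := (Num.truncn (Phi * (2 * n%:R ^+ 2) * s)).+1.
have c_gt : Phi * (2 * n%:R ^+ 2) * s < c%:R.
  by apply: real_truncnS_gt; rewrite num_real.
(* With d = 'C(n, 2), this gives K (2N + 1)^d <= K (2c + 1)^d G^d < G^(d + 1) <= G^r: fewer cells
   than grid points. *)
pose G := (K * (2 * c).+1 ^ 'C(n, 2)).+1; pose N := (G * c)%N.
have G0 : 0 < G%:R :> R by rewrite ltr0n.
have c0 : 0 < c%:R :> R by rewrite ltr0n.
have N0 : (0 < N)%N by rewrite muln_gt0.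
have [T [f [cardT fP]]] := cover N N0.
pose M (p : {ffun 'I_r -> 'I_G}) : 'M[R]_n :=
  \sum_i ((p i)%:R / (G%:R * s)) *: u i.
have MP p : exists X, SO R n X /\ pi X = pi (M p).
  suff [X SX <-] : (pi @` SO R n) (pi (M p)) by exists X.
  apply: (hull_l1_ball cK) => //; first by move=> X SX; exists X.
  apply: (@le_trans _ _ (\sum_k \sum_l \sum_(i < r) `|u i k l| / s)).
    apply: ler_sum => k _; apply: ler_sum => l _; rewrite summxE.
    apply: le_trans (ler_norm_sum _ _ _) (ler_sum _ _) => i _.
    rewrite mxE normrM mulrC; apply: ler_wpM2l => //.
    rewrite ger0_norm ?divr_ge0 ?mulr_ge0 ?ler0n ?(ltW s0) //.
    rewrite invfM mulrA -[leRHS]mul1r; apply: ler_wpM2r.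
      by rewrite invr_ge0 ltW.
    by rewrite ler_pdivrMr // mul1r ler_nat ltnW.
  under eq_bigr do rewrite exchange_big; rewrite exchange_big /=.
  under eq_bigr do under eq_bigr do rewrite -mulr_suml.
  under eq_bigr do rewrite -mulr_suml; rewrite -mulr_suml.
  by rewrite ler_pdivrMr // mul1r lerDr.
have [X XP] := choice MP.
have phiX i p : phi i (X p) = (p i)%:R / (G%:R * s).
  rewrite /phi (proj2 (XP p)) /M !linear_sum (bigD1 i) //= big1 => [|j ji].
    by rewrite !linearZ /= -/(phi i (u i)) phi_u eqxx mulr1 addr0.
  by rewrite !linearZ /= -/(phi i (u j)) phi_u eq_sym (negbTE ji) mulr0.
(* Distinct grid points differ by at least 1 / (G s) in some coordinate [phi i], so their preimages
   in SO(n) lie in different cells. *)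
have inj : injective (f \o X).
  move=> p q fpq; apply: contrapT => /eqP pq.
  have [i pqi] : exists i, p i != q i.
    apply: contrapT => H; move/eqP: pq; apply; apply/ffunP => i.
    by apply: contrapT => /eqP pqi; apply: H; exists i.
  have [[[oXp _] _] [[oXq _] _]] := (XP p, XP q).
  have XN k l : `|(X p - X q) k l| <= 2 * n%:R ^+ 2 / N%:R.
    by have := fP _ _ oXp oXq fpq k l; rewrite !mxE.
  have := phi_le i _ _ XN.
  rewrite /phi !linearB /= -/(phi i (X p)) -/(phi i (X q)) !phiX -mulrBl normrM.
  rewrite [`|(_ * s)^-1|]gtr0_norm ?invr_gt0 ?mulr_gt0 //.
  have pq1 : 1 <= `|(p i)%:R - (q i)%:R : R|.
    have [lt|lt|/val_inj E] := ltngtP (p i) (q i); last by rewrite E eqxx in pqi.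
      by rewrite distrC -natrB 1?ltnW // normr_nat ler1n subn_gt0.
    by rewrite -natrB 1?ltnW // normr_nat ler1n subn_gt0.
  apply/negP; rewrite -ltNge.
  apply: lt_le_trans (_ : (G%:R * s)^-1 <= _); last first.
    by rewrite ler_peMl // invr_ge0 mulr_ge0 // ltW.
  rewrite /N natrM !invfM mulrA mulrCA ltr_pM2l ?invr_gt0 //.
  by rewrite ltr_pdivrMr // ltr_pdivlMl // mulrC.
have := leq_card _ inj; rewrite card_ffun !card_ord; apply/negP; rewrite -ltnNge.
apply: leq_ltn_trans cardT _.
have : (G ^ 'C(n, 2).+1 <= G ^ r)%N by rewrite leq_pexp2l.
apply: leq_trans; rewrite expnSr.
apply: (@leq_ltn_trans (K * ((2 * c).+1 * G) ^ 'C(n, 2))).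
  have d0 : (0 < 'C(n, 2))%N by rewrite bin_gt0 ltnW.
  rewrite leq_mul2l leq_exp2r // (mulSn (2 * c)) -[(2 * N).+1]add1n.
  by rewrite leq_add ?orbT // -mulnA (mulnC c).
by rewrite expnMn mulnA mulnC ltn_pmul2l // expn_gt0.
Qed.

Theorem theorem7 (R : realType) :
  [/\ forall n : nat, (3 <= n)%N ->
        exists pi : 'Hom('M[R]_n, 'rV[R]_3), ~ convex_set (pi @` SO R n),
      forall (n : nat) (A : 'M[R]_n), (3 <= n)%N \/ A^T <> A ->
        ~~ is_diag_mx A -> ~ convex_set (diag_and A @` SO R n),
      forall n : nat, (3 <= n)%N ->
        forall (m : nat) (pi : 'Hom('M[R]_n, 'rV[R]_m)),
          ('C(n, 2) < \dim (limg pi))%N -> ~ convex_set (pi @` SO R n)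
    & forall n : nat, (3 <= n)%N ->
        exists (sigma : {ffun upper_idx n -> R}) (C : 'M[R]_n) (m1 m2 : R),
          [/\ is_diag_mx C,
              is_max [set frob C X | X in
                        SO R n `&` [set X | upper_proj X = sigma]] m1,
              is_max [set frob C X | X in
                        conv_hull (SO R n) `&` [set X | upper_proj X = sigma]] m2
            & m1 < m2] ].
Proof.
split.
- by move=> n; exact: SO_plane_maximally_convex.
- by move=> n A; exact: SO_diag_maximally_convex.
- by move=> n n3 m pi; exact: SO_rank_nonconvex.
- by move=> n; exact: SO_relaxation_gap.
Qed.
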